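(* Let $A_1,\ldots,A_m$ be real $n\times n$ matrices. If the switched linear system $$x_{k+1}\in \mathrm{conv}\{A_1x_k,\ldots,A_mx_k\}$$ is asymptotically stable under arbitrary switching, then there exists a homogeneous polynomial $q$ in $n$ variables such that $q(x)$ is sos-convex and $q(x)-q(A_jx)$ is sos for $j=1,\ldots,m$. Moreover, this polynomial $q$ is positive definite and is such that the $m$ polynomials $q(x)-q(A_jx)$, $j=1,\ldots,m$, are also positive definite.
   Context: $\mathrm{conv}$ denotes the convex hull. A trajectory of the switched linear system is any sequence $(x_k)_{k\ge 0}$ in $\mathbb{R}^n$ with $x_{k+1}\in \mathrm{conv}\{A_1x_k,\ldots,A_mx_k\}$ for all $k$. The system is asymptotically stable under arbitrary switching if the origin is stable in the sense of Lyapunov (for every $\epsilon>0$ there is $\delta>0$ such that every trajectory with $\|x_0\|\le\delta$ satisfies $\|x_k\|\le\epsilon$ for all $k$) and every trajectory converges to the origin. Equivalently, the joint spectral radius $\rho(\mathcal{M})=\lim_{k\to\infty}\max_{M_1,\ldots,M_k\in\mathcal{M}}\|M_1\cdots M_k\|^{1/k}$ of $\mathcal{M}=\{A_1,\ldots,A_m\}$ is strictly less than one. A real polynomial is a sum of squares (sos) if it can be written as $\sum_i q_i^2$ for finitely many real polynomials $q_i$. A real polynomial $p$ in $n$ variables is sos-convex if its Hessian factors as $\nabla^2p(x)=M(x)^TM(x)$ for some (not necessarily square) matrix $M(x)$ with polynomial entries; equivalently, $y^T\nabla^2p(x)y$ is sos as a polynomial in $(x,y)\in\mathbb{R}^{2n}$.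 A homogeneous polynomial $h$ is positive definite if $h(x)>0$ for all $x\neq 0$. *)

(* Defs.v *)
From mathcomp Require Import all_boot all_order all_algebra.
(* mpoly has to be imported before MathComp-Analysis: in the other order the
   associativity that it declares for notations at level 2 is rejected. *)
From mathcomp Require Import mpoly.
From mathcomp Require Import boolp classical_sets reals topology normedtype.
From mathcomp Require Import convex.

Set Implicit Arguments.
Unset Strict Implicit.
Unset Printing Implicit Defensive.

Import Order.TTheory GRing.Theory Num.Theory.
Import numFieldNormedType.Exports.

Local Open Scope classical_set_scope.
Local Open Scope ring_scope.

Definition conv (R : numDomainType) (E : lmodType R) (A : set E) : set E :=
  smallest (@convex_set R E) A.

Definition trajectory (R : realType) (n m : nat) (A : 'I_m -> 'M[R]_n)
    (x : nat -> 'cV[R]_n) : Prop :=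
  forall k, conv [set A j *m x k | j in [set: 'I_m]] (x k.+1).

(* The norm on 'cV[R]_n is the library's (sup) norm; as all norms on R^n are
   equivalent, neither condition depends on this choice. *)
Definition lyapunov_stable (R : realType) (n m : nat)
    (A : 'I_m -> 'M[R]_n) : Prop :=
  forall eps : R, 0 < eps -> exists2 delta : R, 0 < delta &
    forall x : nat -> 'cV[R]_n, trajectory A x ->
      `|x 0%N| <= delta -> forall k, `|x k| <= eps.

Definition asymptotically_stable (R : realType) (n m : nat)
    (A : 'I_m -> 'M[R]_n) : Prop :=
  lyapunov_stable A /\
  forall x : nat -> 'cV[R]_n, trajectory A x -> x k @[k --> \oo] --> (0 : 'cV[R]_n).

Definition sos (R : realType) (n : nat) (p : {mpoly R[n]}) : Prop :=
  exists s : seq {mpoly R[n]}, p = \sum_(q <- s) q ^+ 2.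

Definition hessian (R : realType) (n : nat) (p : {mpoly R[n]}) :
    'M[{mpoly R[n]}]_n :=
  \matrix_(i, j) p^`M(i)^`M(j).

Definition sos_convex (R : realType) (n : nat) (p : {mpoly R[n]}) : Prop :=
  exists (r : nat) (M : 'M[{mpoly R[n]}]_(r, n)), hessian p = M^T *m M.

Definition homogeneous (R : realType) (n : nat) (p : {mpoly R[n]}) : Prop :=
  exists d : nat, p \is d.-homog.

Definition pos_def (R : realType) (n : nat) (p : {mpoly R[n]}) : Prop :=
  forall x : 'cV[R]_n, x != 0 -> 0 < p.@[fun i => x i 0].

(* The polynomial p(Bx): the i-th variable is replaced by the i-th entry
   of Bx. *)
Definition subst_lin (R : realType) (n : nat) (B : 'M[R]_n)
    (p : {mpoly R[n]}) : {mpoly R[n]} :=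
  p \mPo [tuple \sum_(k < n) B i k *: 'X_k | i < n].

(* Main.v *)
(* Stability makes all products of [T] matrices uniformly small, for [T] large.
   Put Q_k(x) = sum of (v x)^d over the rows v of all products of k matrices, and
   q = Q_0 + ... + Q_{T-1}.  A sum of even powers of linear forms is sos-convex,
   and since Q_{k+1} = sum_j Q_k o A_j,
     q - q o A_j = Q_0 - Q_T + (a sum of even powers of linear forms).
   For d = 2^s the power mean inequality is an sos identity, which bounds each
   summand of Q_T by 2^{-d} Q_0.  The number of summands does not depend on d, so
   for d large Q_0 / 2 - Q_T is sos. *)
Require Import Defs.
From mathcomp Require Import all_boot all_order all_algebra.
From mathcomp Require Import mpoly.
From mathcomp Require Import reals.
From mathcomp Require Import boolp classical_sets topology normedtype.
From mathcomp Require Import ring.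

Set Implicit Arguments.
Unset Strict Implicit.
Unset Printing Implicit Defensive.

Import Order.TTheory GRing.Theory Num.Theory.
Import numFieldNormedType.Exports.

Local Open Scope ring_scope.

(** * Sums of squares and the power mean inequality *)

Section SumsOfSquares.
Context {R : realType} {n : nat}.
Implicit Types (p q : {mpoly R[n]}) (c : R).

Lemma sos0 : sos (0 : {mpoly R[n]}).
Proof. by exists [::]; rewrite big_nil. Qed.

Lemma sosD p q : sos p -> sos q -> sos (p + q).
Proof. by move=> [s ->] [t ->]; exists (s ++ t); rewrite big_cat. Qed.

Lemma sos_sum I (s : seq I) (P : pred I) (F : I -> {mpoly R[n]}) :
  (forall i, P i -> sos (F i)) -> sos (\sum_(i <- s | P i) F i).
Proof. by move=> sosF; apply: big_ind => //; [exact: sos0 | exact: sosD]. Qed.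

Lemma sos_sqr p : sos (p ^+ 2).
Proof. by exists [:: p]; rewrite big_seq1. Qed.

Lemma sosM p q : sos p -> sos q -> sos (p * q).
Proof.
move=> [s ->] [t ->]; exists [seq f * g | f <- s, g <- t].
rewrite big_allpairs_dep mulr_suml; apply: eq_bigr => f _.
by rewrite mulr_sumr; apply: eq_bigr => g _; rewrite exprMn.
Qed.

Lemma sosZ c p : 0 <= c -> sos p -> sos (c *: p).
Proof.
move=> c_ge0 sosp; rewrite -mul_mpolyC; apply: sosM => //.
by rewrite -(sqr_sqrtr c_ge0) rmorphXn; exact: sos_sqr.
Qed.

Lemma sos_even_pow p k : sos (p ^+ (2 ^ k.+1)).
Proof. by rewrite expnSr exprM; exact: sos_sqr. Qed.

Lemma sos_trans p q r : sos (q - p) -> sos (r - q) -> sos (r - p).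
Proof. by move=> pq qr; rewrite -(subrK q r) -addrA; exact: sosD. Qed.

Lemma sos_ler_scale (c d : R) p : c <= d -> sos p -> sos (d *: p - c *: p).
Proof. by move=> cd sosp; rewrite -scalerBl; apply: sosZ; rewrite ?subr_ge0. Qed.

Lemma sos_mevalr_ge0 p (v : 'I_n -> R) : sos p -> 0 <= p.@[v].
Proof.
move=> [s ->]; rewrite raddf_sum /=; apply: sumr_ge0 => q _.
by rewrite rmorphXn /= sqr_ge0.
Qed.

Lemma pos_def_sos p q : sos (p - q) -> pos_def q -> pos_def p.
Proof.
move=> sospq q_pos x /q_pos qx; apply: (lt_le_trans qx).
by have := sos_mevalr_ge0 (fun i => x i 0) sospq; rewrite mevalB subr_ge0.
Qed.

(** Lagrange's identity: the difference is half the sum of [(F i - F j) ^+ 2] over all ordered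
    pairs. *)
Lemma sos_Cauchy_Schwarz I (s : seq I) (F : I -> {mpoly R[n]}) :
  sos ((size s)%:R *: (\sum_(i <- s) F i ^+ 2) - (\sum_(i <- s) F i) ^+ 2).
Proof.
have -> : (size s)%:R *: (\sum_(i <- s) F i ^+ 2) - (\sum_(i <- s) F i) ^+ 2 =
    2^-1 *: (\sum_(i <- s) \sum_(j <- s) (F i - F j) ^+ 2).
  have sumC (x : {mpoly R[n]}) : \sum_(j <- s) x = (size s)%:R *: x.
    by rewrite big_const_seq count_predT -Monoid.iteropE scaler_nat.
  set S := \sum_(i <- s) F i ^+ 2; set T := \sum_(i <- s) F i.
  have row_sum i : \sum_(j <- s) (F i - F j) ^+ 2 =
      (size s)%:R *: F i ^+ 2 - F i * T *+ 2 + S.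
    rewrite mulr_sumr -sumrMnl -sumC -sumrB -big_split.
    by apply: eq_bigr => j _; rewrite sqrrB.
  under [X in _ = _ *: X]eq_bigr do rewrite row_sum.
  rewrite big_split sumrB sumrMnl -mulr_suml -scaler_sumr sumC -/S -/T /=.
  rewrite -expr2 addrAC -mulr2n -mulrnBl.
  set D := _ - T ^+ 2; rewrite -[D *+ 2]scaler_nat scalerA mulVf ?scale1r //.
  by rewrite pnatr_eq0.
apply: sosZ; first by rewrite invr_ge0 ler0n.
by apply: sos_sum => i _; apply: sos_sum => j _; exact: sos_sqr.
Qed.

(* Each doubling of the exponent factors [b^2 - a^2] as [(b - a)(b + a)]. *)
Lemma sos_power_mean I (s : seq I) (F : I -> {mpoly R[n]}) k :
  sos ((size s)%:R ^+ (2 ^ k.+1).-1 *: (\sum_(i <- s) F i ^+ (2 ^ k.+1))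
       - (\sum_(i <- s) F i) ^+ (2 ^ k.+1)).
Proof.
elim: k => [|k IHk]; first exact: sos_Cauchy_Schwarz.
set d := (2 ^ k.+1)%N in IHk *; set N : R := (size s)%:R in IHk *.
have d2 : (2 ^ k.+2 = d * 2)%N by rewrite expnSr.
set b := _ *: _ in IHk; set a := _ ^+ d in IHk.
apply: (@sos_trans _ (b ^+ 2)).
  rewrite d2 exprM subr_sqr; apply: sosM => //; apply: sosD; last exact: sos_even_pow.
  apply: sosZ; first by rewrite exprn_ge0 // ler0n.
  by apply: sos_sum => i _; exact: sos_even_pow.
(* Since 2d - 1 = 2(d - 1) + 1, the factor N^(2(d-1)) comes out, and Cauchy-Schwarz for the
   [F i ^+ d] remains. *)
have -> : (2 ^ k.+2).-1 = (d.-1 * 2 + 1)%N.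
  have d_gt0 : (0 < d)%N by rewrite expn_gt0.
  by rewrite d2 -{1}(prednK d_gt0) mulSn addn1.
rewrite /b exprZn exprD exprM expr1 -scalerA -scalerBr.
apply: sosZ; first by rewrite exprn_ge0 // exprn_ge0 // ler0n.
under eq_bigr do rewrite d2 exprM.
exact: sos_Cauchy_Schwarz.
Qed.

End SumsOfSquares.

(** * Sums of even powers of linear forms *)

Section PowerSums.
Context {R : realType} {n : nat}.
Implicit Types (v : 'rV[R]_n) (L : seq 'rV[R]_n).

Definition lin_form v : {mpoly R[n]} := \sum_(k < n) v 0 k *: 'X_k.

Definition power_sum d L : {mpoly R[n]} := \sum_(v <- L) lin_form v ^+ d.

Definition unit_rows : seq 'rV[R]_n := [seq row i 1%:M | i <- enum 'I_n].

Lemma lin_form_unit i : lin_form (row i 1%:M) = 'X_i.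
Proof.
rewrite /lin_form (bigD1 i) //= !mxE eqxx scale1r big1 ?addr0 // => k ki.
by rewrite !mxE eq_sym (negbTE ki) scale0r.
Qed.

Lemma power_sum_unit d : power_sum d unit_rows = \sum_(i < n) 'X_i ^+ d.
Proof.
by rewrite /power_sum big_map big_enum; apply: eq_bigr => i _; rewrite lin_form_unit.
Qed.

Lemma subst_lin_power_sum (B : 'M[R]_n) d L :
  subst_lin B (power_sum d L) = power_sum d [seq v *m B | v <- L].
Proof.
rewrite /subst_lin /power_sum raddf_sum big_map; apply: eq_bigr => v _ /=.
rewrite rmorphXn /=; congr (_ ^+ _); rewrite /lin_form raddf_sum /=.
under [RHS]eq_bigr do rewrite !mxE scaler_suml.
rewrite exchange_big; apply: eq_bigr => i _ /=.
rewrite comp_mpolyZ comp_mpolyXU -tnth_nth tnth_mktuple scaler_sumr.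
by apply: eq_bigr => k _; rewrite scalerA.
Qed.

Lemma homogeneous_power_sum d L : power_sum d L \is d.-homog.
Proof.
apply: rpred_sum => v _; rewrite -{2}(mul1n d); apply: dhomogMn.
by apply: rpred_sum => k _; apply: rpredZ; rewrite dhomogX /= mdeg1.
Qed.

Lemma sos_power_sum k L : sos (power_sum (2 ^ k.+1) L).
Proof. by apply: sos_sum => v _; exact: sos_even_pow. Qed.

Lemma mderiv_sum I (s : seq I) (P : pred I) (F : I -> {mpoly R[n]}) i :
  (\sum_(r <- s | P r) F r)^`M(i) = \sum_(r <- s | P r) (F r)^`M(i).
Proof. exact: raddf_sum. Qed.

Lemma mderiv_lin_form v i : (lin_form v)^`M(i) = (v 0 i)%:MP.
Proof.
rewrite mderiv_sum (bigD1 i) //= big1 => [|k ki].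
  by rewrite mderivZ mderivX mnm1E eqxx -{1}(add0m U_(i)%MM) addmK mpolyX0 scale1r
    addr0 -mul_mpolyC mulr1.
by rewrite mderivZ mderivX mnm1E (negbTE ki) scale0r scaler0.
Qed.

Lemma mderiv_lin_form_pow v i d :
  (lin_form v ^+ d)^`M(i) = (v 0 i * d%:R) *: lin_form v ^+ d.-1.
Proof.
elim: d => [|d IHd]; first by rewrite expr0 -mpolyC1 mderivC mulr0 scale0r.
rewrite exprS mderivM IHd mderiv_lin_form mul_mpolyC /= -scalerAr.
case: d IHd => [|d] _ /=; first by rewrite mulr0 scale0r addr0 mulr1.
by rewrite -exprS -scalerDl -[d.+2%:R]natr1 mulrDr mulr1 addrC.
Qed.

(** The Hessian of (v x)^d is d(d-1) (v x)^(d-2) v^T v, and d - 2 = 2(2^k - 1) is even. So each [v]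
    contributes to the factor [M] the single row sqrt(d(d-1)) (v x)^((d-2)/2) v. *)
Lemma sos_convex_power_sum k L : sos_convex (power_sum (2 ^ k.+1) L).
Proof.
set d := (2 ^ k.+1)%N; pose c : R := Num.sqrt (d%:R * d.-1%:R).
exists (size L), (\matrix_(r, i)
  ((c * (L`_r) 0 i) *: lin_form (L`_r) ^+ (2 ^ k).-1)).
apply/matrixP => i j; rewrite !mxE /power_sum (big_nth 0) big_mkord (mderiv_sum _ _ _ i) (mderiv_sum _ _ _ j).
apply: eq_bigr => r _; rewrite !mxE mderiv_lin_form_pow mderivZ mderiv_lin_form_pow.
rewrite -scalerAl -scalerAr !scalerA -exprD; congr (_ *: _ ^+ _).
  have c2 : c * c = d%:R * d.-1%:R by rewrite -expr2 sqr_sqrtr // mulr_ge0 ?ler0n.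
  by rewrite [RHS]mulrACA c2; ring.
rewrite /d expnS mul2n -addnn; have : (0 < 2 ^ k)%N by rewrite expn_gt0.
by case: (2 ^ k)%N => // e _; rewrite /= addnS.
Qed.

Lemma pos_def_power_sum_unit (c : R) k : 0 < c ->
  pos_def (c *: power_sum (2 ^ k.+1) unit_rows).
Proof.
move=> c_gt0 x; rewrite power_sum_unit mevalZ => x_neq0; apply: mulr_gt0 => //.
have ev i : ('X_i ^+ (2 ^ k.+1) : {mpoly R[n]}).@[fun i => x i 0] = x i 0 ^+ (2 ^ k.+1).
  by rewrite rmorphXn /= mevalXU.
rewrite raddf_sum /=; under eq_bigr do rewrite ev.
have even_ge0 i : 0 <= x i 0 ^+ (2 ^ k.+1) by rewrite expnSr exprM sqr_ge0.
rewrite lt0r sumr_ge0 // andbT; apply: contra x_neq0.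
rewrite psumr_eq0 // => /allP x0; apply/eqP/matrixP => i j; rewrite ord1 mxE.
have := x0 i (mem_index_enum i); rewrite /= expf_eq0 expn_gt0.
by move/eqP.
Qed.

(** The power mean inequality for the n terms v_i X_i bounds (v x)^d by n^(d-1) times the sum of the
    v_i^d X_i^d. Weakening n^(d-1) to (n+1)^d makes the constant per row a pure d-th power, small
    once (n+1)e < 1. *)
Lemma sos_power_sum_le k (e : R) L : 0 <= e ->
  (forall v, v \in L -> forall i, `|v 0 i| <= e) ->
  sos (((size L)%:R * (n.+1%:R * e) ^+ (2 ^ k.+1)) *: power_sum (2 ^ k.+1) unit_rows
       - power_sum (2 ^ k.+1) L).
Proof.
move=> e_ge0 Le; set d := (2 ^ k.+1)%N.
(* The factor [size L] becomes a sum over [L], leaving one inequality per row. *)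
rewrite -scalerA scaler_nat /power_sum -iter_addr_0 -count_predT -big_const_seq.
rewrite -sumrB big_seq; apply: sos_sum => v /Le ve.
rewrite -/(power_sum _ _) power_sum_unit.
have := sos_power_mean (enum 'I_n) (fun i => v 0 i *: 'X_i : {mpoly R[n]}) k.
rewrite !big_enum size_enum_ord -/(lin_form v) -/d; move/sos_trans; apply.
rewrite !scaler_sumr -sumrB; apply: sos_sum => i _; rewrite [(v 0 i *: _) ^+ _]exprZn scalerA.
apply: sos_ler_scale; last exact: sos_even_pow.
have d_gt0 : (0 < d)%N by rewrite expn_gt0.
have -> : v 0 i ^+ d = `|v 0 i| ^+ d.
  by rewrite /d expnS !exprM real_normK ?num_real.
rewrite exprMn; apply: ler_pM; rewrite ?exprn_ge0 ?ler0n //; last first.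
  by rewrite lerXn2r ?nnegrE.
apply: (@le_trans _ _ (n.+1%:R ^+ d.-1)).
  by rewrite lerXn2r ?nnegrE ?ler0n // ler_nat.
by rewrite -{2}(prednK d_gt0) exprS ler_peMl ?exprn_ge0 ?ler0n // ler1n.
Qed.

End PowerSums.

(** * Matrix products along words, and the decay forced by stability *)

Section Products.
Context {R : realType} {n m : nat}.
Variable A : 'I_m -> 'M[R]_n.
Implicit Types (u w : seq 'I_m) (x : 'cV[R]_n).

(* The first letter of the word acts first, hence is the rightmost factor. *)
Fixpoint word_mx w : 'M[R]_n := if w is j :: w' then word_mx w' *m A j else 1%:M.

Lemma word_mx_cat u w : word_mx (u ++ w) = word_mx w *m word_mx u.
Proof.
by elim: u => [|j u IHu] /=; [rewrite mulmx1 | rewrite IHu mulmxA].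
Qed.

Lemma word_mx_rcons w j : word_mx (rcons w j) = A j *m word_mx w.
Proof. by rewrite -cats1 word_mx_cat /= mul1mx. Qed.

(** Stability is only ever tested on trajectories that apply one of the matrices at each step. *)
Lemma trajectory_word (s : nat -> 'I_m) x :
  trajectory A (fun k => word_mx (mkseq s k) *m x).
Proof.
move=> k; apply: sub_gen_smallest; exists (s k) => //.
by rewrite mulmxA -word_mx_rcons -mkseqS.
Qed.

Lemma stable_word (eps : R) : lyapunov_stable A -> 0 < eps ->
  exists2 delta : R, 0 < delta &
    forall w x, `|x| <= delta -> `|word_mx w *m x| <= eps.
Proof.
move=> stabA eps_gt0; have [delta delta_gt0 stab] := stabA _ eps_gt0.
(* A nonempty word is prolonged by repeating its first letter. The empty word has no such default,
   and the minimum with [eps] settles it. *)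
exists (Num.min delta eps) => [|w x]; first by rewrite lt_min delta_gt0.
rewrite le_min => /andP[x_delta x_eps].
case: w => [|j w]; first by rewrite /= mul1mx.
have := stab _ (@trajectory_word (nth j (j :: w)) x).
rewrite /= mul1mx => /(_ x_delta (size (j :: w))).
by rewrite -/(mkseq _ _) mkseq_nth.
Qed.

Definition word_le (eps : R) w := forall a b, `|word_mx w a b| <= eps.

Lemma entry_le_norm x (a : 'I_n) : `|x a 0| <= `|x|.
Proof.
rewrite [X in _ <= X]mx_normrE; exact: (le_bigmax _ (fun i => `|x i.1 i.2|) (a, 0)).
Qed.

(* Koenig's lemma: if arbitrarily long words had a large entry, some infinite
   word would have all its prefixes extendable to such words, although along it
   the products tend to 0 and a small prefix keeps all its extensions small. *)
Lemma long_words_small (eps : R) : asymptotically_stable A -> 0 < eps ->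
  exists T, forall w, (T <= size w)%N -> word_le eps w.
Proof.
move=> [stabA convA] eps_gt0.
pose ext u := forall T, exists2 w, (T <= size w)%N & ~ word_le eps (u ++ w).
have [[T ext0] | ext0] := pselect (exists T, forall w, (T <= size w)%N -> word_le eps w).
  by exists T.
have {}ext0 : ext [::].
  move=> T; apply: contra_notP ext0 => no_w; exists T => w Tw.
  by apply: contrapT => bad_w; apply: no_w; exists w.
have [delta delta_gt0 stab] := stable_word stabA eps_gt0.
have ext_rcons u : ext u -> exists j, ext (rcons u j).
  move=> ext_u; apply: contrapT => no_j.
  have {no_j} /choice [T bound] : forall j, exists T,
      forall w, (T <= size w)%N -> word_le eps (rcons u j ++ w).
    move=> j; apply: contrapT => no_T; apply: no_j; exists j => T.
    apply: contrapT => no_w; apply: no_T; exists T => w Tw.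
    by apply: contrapT => bad_w; apply: no_w; exists w.
  (* The successor pays for the first letter [j], which moves into the prefix. *)
  have [[|j w] // le_w bad_w] := ext_u (\max_j T j).+1.
  apply: bad_w; rewrite -cat_rcons; apply: bound.
  exact: leq_trans (leq_bigmax j) le_w.
have /choice [next ext_next] : forall u, exists j, ext u -> ext (rcons u j).
  move=> u; have [/ext_rcons [j ext_j] | no_ext] := pselect (ext u); first by exists j.
  (* Any letter will do here; a nonempty bad word shows that there is one. *)
  have [[|j w'] // _ _] := ext0 1%N.
  by exists j.
pose pre := fix pre k := if k is k'.+1 then rcons (pre k') (next (pre k')) else [::].
have ext_pre k : ext (pre k) by elim: k => //= k; exact: ext_next.
have preE k : pre k = mkseq (fun i => next (pre i)) k.
  by elim: k => // k IHk; rewrite mkseqS -IHk.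
(* The columns of the prefix products are trajectories from the basis vectors; being finitely many,
   they are small from a common [k] on. *)
have : \forall k \near \oo%classic, forall b : 'I_n, `|col b (word_mx (pre k))| <= delta.
  apply: filter_forall => b.
  have /cvgr0Pnorm_le := convA _ (@trajectory_word (fun i => next (pre i)) (delta_mx b 0)).
  move=> /(_ _ delta_gt0); apply: filterS => k.
  by rewrite -preE -colE.
move=> [k _ /(_ k (leqnn k)) small_k].
(* Column by column, the product along [pre k ++ w] is [word_mx w] applied to vectors of norm at
   most [delta], so Lyapunov stability bounds it whatever [w] is. *)
have [w _ bad_w] := ext_pre k 0%N.
exfalso; apply: bad_w => a b.
rewrite word_mx_cat; apply: le_trans (stab w _ (small_k b)).
have -> : (word_mx w *m word_mx (pre k)) a b = (word_mx w *m col b (word_mx (pre k))) a 0.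
  by rewrite colE mulmxA -colE [RHS]mxE.
exact: entry_le_norm.
Qed.

(** Substituting A_j x in the form v x gives the form of the row v A_j, hence the multiplication on
    the right. Repetitions are kept, so the recursion for the power sums is exact. *)
Fixpoint word_rows k : seq 'rV[R]_n :=
  if k is k'.+1 then [seq v *m A j | v <- word_rows k', j <- enum 'I_m]
  else unit_rows.

Lemma word_rowsP k v : v \in word_rows k ->
  exists w a, size w = k /\ v = row a (word_mx w).
Proof.
elim: k v => [|k IHk] v /= => [/mapP [a _ ->] | /allpairsP [[u j] /= [/IHk]]].
  by exists [::], a.
move=> [w [a [size_w ->]]] _ ->; exists (j :: w), a.
by rewrite /= size_w row_mul.
Qed.

Lemma sum_power_sum_word_rows d T :
  \sum_(k < T) power_sum d (word_rows k) =
  power_sum d (flatten [seq word_rows k | k <- index_iota 0 T]).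
Proof. by rewrite /power_sum big_flatten big_map big_mkord. Qed.

Lemma power_sum_word_rowsS d k :
  power_sum d (word_rows k.+1) = \sum_j subst_lin (A j) (power_sum d (word_rows k)).
Proof.
under eq_bigr do rewrite subst_lin_power_sum.
rewrite /power_sum /= big_allpairs_dep exchange_big /=; rewrite big_enum; apply: eq_bigr => j _.
by rewrite big_map.
Qed.

(** Q_k o A_j is Q_(k+1) minus the terms Q_k o A_i with i != j, and the differences Q_k - Q_(k+1)
    telescope. *)
Lemma power_sum_word_rows_telescope d T j :
  let q := \sum_(k < T) power_sum d (word_rows k) in
  q - subst_lin (A j) q = power_sum d unit_rows - power_sum d (word_rows T)
    + \sum_(k < T) \sum_(i | i != j) power_sum d [seq v *m A i | v <- word_rows k].
Proof.
elim: T => [|T IHT] /=.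
  by rewrite !big_ord0 /subst_lin comp_mpoly0 !subr0 subrr add0r.
rewrite !big_ord_recr /= -/(word_rows T.+1) power_sum_word_rowsS (bigD1 j) //=.
rewrite /subst_lin comp_mpolyD -!/(subst_lin _ _) opprD addrACA IHT.
rewrite [X in _ - (_ + X)](eq_bigr _ (fun i _ => subst_lin_power_sum (A i) d _)).
ring.
Qed.

End Products.

(** * Choice of the degree and construction of the polynomial *)

Lemma leq_muln2_exp_exp k : (k * 2 <= 2 ^ (2 ^ k.+1))%N.
Proof.
have lt_exp i : (i < 2 ^ i)%N by exact: ltn_expl.
rewrite (leq_trans (n := 2 ^ k.+1)%N) //.
  by rewrite expnSr leq_mul2r /= (ltnW (lt_exp k)).
by rewrite leq_pexp2l // (ltnW (lt_exp k.+1)).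
Qed.

Theorem theorem3p4 (R : realType) (n m : nat) (A : 'I_m -> 'M[R]_n) :
  asymptotically_stable A ->
  exists q : {mpoly R[n]},
    [/\ homogeneous q,
        sos_convex q,
        (forall j : 'I_m, sos (q - subst_lin (A j) q)),
        pos_def q &
        forall j : 'I_m, pos_def (q - subst_lin (A j) q)].
Proof.
(* Chosen so that (n+1)e = 1/2. *)
move=> stabA; pose e : R := (2 * n.+1%:R)^-1.
have e_gt0 : 0 < e by rewrite invr_gt0 mulr_gt0 ?ltr0n.
have [T small] := long_words_small stabA e_gt0.
(* [T.+1] makes the sum [q] nonempty, so that it contains [Q0]. The degree may depend on [N], since
   the rows are fixed before it. *)
pose L := word_rows A T.+1; pose N := size L; pose d := (2 ^ N.+1)%N.
pose q := \sum_(k < T.+1) power_sum d (word_rows A k).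
pose Q0 : {mpoly R[n]} := power_sum d unit_rows.
have qE : q = power_sum d (flatten [seq word_rows A k | k <- index_iota 0 T.+1]).
  exact: sum_power_sum_word_rows.
have L_small : sos (2^-1 *: Q0 - power_sum d L).
  have L_le v : v \in L -> forall i, `|v 0 i| <= e.
    move=> /word_rowsP [w [a [size_w ->]]] i; rewrite mxE.
    by apply: small; rewrite size_w.
  apply: sos_trans (sos_power_sum_le N (ltW e_gt0) L_le) _.
  apply: sos_ler_scale; last exact: sos_power_sum.
  have -> : n.+1%:R * e = 2^-1 by rewrite /e invfM mulrCA mulfV ?mulr1 ?pnatr_eq0.
  (* It remains to see that N 2^(-d) <= 1/2, that is, 2N <= 2^d. *)
  rewrite -/d -/N exprVn ler_pdivrMr ?exprn_gt0 ?ltr0n // mulrC.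
  rewrite ler_pdivlMr ?ltr0n // -natrX -natrM ler_nat.
  exact: leq_muln2_exp_exp.
(* Only half of [Q0] is spent on absorbing [power_sum d L]; the other half makes the decrease
   positive definite. *)
have q_decrease j : sos (q - subst_lin (A j) q - 2^-1 *: Q0).
  rewrite /q power_sum_word_rows_telescope -/Q0 -/L.
  rewrite [X in sos X](_ : _ = (2^-1 *: Q0 - power_sum d L) +
    \sum_(k < T.+1) \sum_(i | i != j)
      power_sum d [seq v *m A i | v <- word_rows A k]); last first.
    have half_add (p : {mpoly R[n]}) : p = 2^-1 *: p + 2^-1 *: p.
      by rewrite -scalerDl -[2^-1]div1r -splitr scale1r.
    have cancel_half (h p s : {mpoly R[n]}) : h + h - p + s - h = h - p + s by ring.
    by rewrite {1}(half_add Q0) cancel_half.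
  apply: sosD => //; apply: sos_sum => k _; apply: sos_sum => i _.
  exact: sos_power_sum.
exists q; split.
- by exists d; rewrite qE; exact: homogeneous_power_sum.
- by rewrite qE; exact: sos_convex_power_sum.
- move=> j; rewrite -[q - _](subrK (2^-1 *: Q0)); apply: sosD => //.
  by apply: sosZ; rewrite ?invr_ge0 ?ler0n //; exact: sos_power_sum.
- apply: (@pos_def_sos _ _ _ (1 *: Q0)); last exact: pos_def_power_sum_unit.
  rewrite scale1r /q big_ord_recl addrAC subrr add0r.
  by apply: sos_sum => k _; exact: sos_power_sum.
- move=> j; apply: pos_def_sos (q_decrease j) _.
  by apply: pos_def_power_sum_unit; rewrite invr_gt0 ltr0n.
Qed.
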